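(* Let $\mathcal{A}$ and $\mathcal{B}$ be structures. If $F:Iso(\mathcal{A})\to Iso(\mathcal{B})$ is a computable functor, then $F$ is enumerable.
   Context: Structures: all structures are countable with universe $\omega$, in a relational language $(R_i)_{i\in\omega}$ where $R_i$ has arity $a_i$ and $i\mapsto a_i$ is computable. The languages of $\mathcal{A}$ and $\mathcal{B}$ may differ. A class of structures (in a fixed language) is viewed as a category whose morphisms are the isomorphisms between its members; $Hom(\mathcal{A},\mathcal{B})$ is the set of isomorphisms from $\mathcal{A}$ to $\mathcal{B}$. $Iso(\mathcal{A})=\{\mathcal{C}:\mathcal{C}\cong\mathcal{A}\}$ (structures with universe $\omega$). A functor maps structures to structures and isomorphisms $f:\mathcal{C}\to\mathcal{D}$ to isomorphisms $F(f):F(\mathcal{C})\to F(\mathcal{D})$, preserving composition and identities. Coding: tuples of natural numbers are coded by numbers via a fixed computable coding $\langle\cdot\rangle$, and $\oplus$ and $\bigoplus_{i\in\omega}$ denote the usual effective joins of sets. The atomic diagram of $\mathcal{A}$ is $D(\mathcal{A})=\bigoplus_{i\in\omega}R_i^{\mathcal{A}}\oplus\bigoplus_{i\in\omega}\neg R_i^{\mathcal{A}}$, and $Graph(f)=\{\langle x,y\rangle: f(x)=y\}$. An enumeration operator $\Psi$ is a c.e. set of pairs $(E,x)$ with $E$ (a code of) a finite set, and $\Psi^X=\{x:\exists E\subseteq X\ (E,x)\in\Psi\}$. For a Turing operator $\Phi$ and a set $Y$, $\Phi^X=Y$ means that $\Phi$ computes the characteristic function of $Y$ from the oracle $X$; for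 a function $g$, $\Phi^X=g$ means $\Phi$ computes $g$ from $X$. A functor $F:\mathfrak{C}\to\mathfrak{D}$ is computable if there are Turing operators $\Phi,\Phi_*$ such that for all $\mathcal{C}_1,\mathcal{C}_2\in\mathfrak{C}$: (1) $\Phi^{D(\mathcal{C}_1)}=D(F(\mathcal{C}_1))$; (2) for all $f\in Hom(\mathcal{C}_1,\mathcal{C}_2)$, $\Phi_*^{D(\mathcal{C}_1)\oplus Graph(f)\oplus D(\mathcal{C}_2)}=F(f)$. A functor $F:\mathfrak{C}\to\mathfrak{D}$ is enumerable if there are enumeration operators $\Psi,\Psi_*$ such that for all $\mathcal{C}_1,\mathcal{C}_2\in\mathfrak{C}$: (1) $\Psi^{D(\mathcal{C}_1)}=D(F(\mathcal{C}_1))$; (2) for all $f\in Hom(\mathcal{C}_1,\mathcal{C}_2)$, $\Psi_*^{D(\mathcal{C}_1)\oplus Graph(f)\oplus D(\mathcal{C}_2)}=Graph(F(f))$. *)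

(* Defs.v *)
From mathcomp Require Import all_boot.
From mathcomp Require Import boolp classical_sets.

Set Implicit Arguments.
Unset Strict Implicit.
Unset Printing Implicit Defensive.

Local Open Scope nat_scope.
Local Open Scope classical_set_scope.

(* Programs for the partial recursive functions of n arguments relative to an
   oracle, which is a subset of nat. *)
Inductive recfun : nat -> Type :=
| Zero n : recfun n
| Succ : recfun 1
| Oracle : recfun 1
| Proj n (i : 'I_n) : recfun n
| Comp m n (f : recfun m) (g : 'I_m -> recfun n) : recfun n
| Prec n (f : recfun n) (g : recfun n.+2) : recfun n.+1
| Mu n (f : recfun n.+1) : recfun n.

(* [eval X c v y]: with oracle X, the program c halts on v with value y.
   Primitive recursion is on the first argument: h(0, v) = f(v) and
   h(k + 1, v) = g(k, h(k, v), v).  Minimization returns the least y with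
   f(y, v) = 0, and needs f(k, v) to be defined for all k < y.  The boolean
   [x \in X] is read as 0 or 1. *)
Fixpoint eval (X : set nat) n (c : recfun n) : n.-tuple nat -> nat -> Prop :=
  match c in recfun n return n.-tuple nat -> nat -> Prop with
  | Zero _ => fun _ y => y = 0
  | Succ => fun v y => y = (thead v).+1
  | Oracle => fun v y => y = (thead v \in X)
  | Proj _ i => fun v y => y = tnth v i
  | Comp m n f g => fun v y => exists w : m.-tuple nat,
      (forall i, eval X (g i) v (tnth w i)) /\ eval X f w y
  | Prec n f g => fun v =>
      let u : n.-tuple nat := behead_tuple v in
      (fix h (k : nat) : nat -> Prop :=
         if k is k'.+1
         then fun y => exists z, h k' z /\ eval X g [tuple of k' :: z :: u] y
         else eval X f u) (thead v)
  | Mu n f => fun v y =>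
      eval X f [tuple of y :: v] 0 /\
      forall k, k < y -> exists z, eval X f [tuple of k :: v] z.+1
  end.

(* A Turing operator is a unary program run with an arbitrary oracle. *)
Definition turing_op := recfun 1.

Definition turing_computes (Phi : turing_op) (X : set nat) (g : nat -> nat) :=
  forall n, eval X Phi [tuple n] (g n).

Definition turing_decides (Phi : turing_op) (X Y : set nat) :=
  turing_computes Phi X (fun n => n \in Y).

(* Unrelativized computability is computability from the empty oracle. *)
Definition computable (f : nat -> nat) :=
  exists Phi : turing_op, turing_computes Phi set0 f.

Definition ce (W : set nat) :=
  exists c : recfun 1, forall n, W n <-> exists y, eval set0 c [tuple n] y.

(* [CodeSeq.code] is a bijection from finite sequences of numbers to numbers;
   it codes tuples of all lengths. *)
Definition pair_code (x y : nat) : nat := CodeSeq.code [:: x; y].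

Definition join (X Y : set nat) : set nat :=
  [set n.*2 | n in X] `|` [set n.*2.+1 | n in Y].

Definition bigjoin (X : nat -> set nat) : set nat :=
  [set n | exists i x, X i x /\ n = pair_code i x].

Definition graph (f : nat -> nat) : set nat :=
  [set pair_code x (f x) | x in [set: nat]].

(* The finite set with canonical index u = \sum_(x in E) 2 ^ x. *)
Definition finite_of_code (u : nat) : set nat := [set x | odd (u %/ 2 ^ x)].

(* [W] consists of the codes of the pairs (E, x). *)
Definition enum_apply (W X : set nat) : set nat :=
  [set x | exists u, finite_of_code u `<=` X /\ W (pair_code u x)].

Record language := Language {
  arity :> nat -> nat;
  arity_computable : computable arity
}.

Definition structure (L : language) := forall i, set ((L i).-tuple nat).

(* The negation of a relation is its complement among tuples of its arity. *)
Definition diagram L (A : structure L) : set nat :=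
  join (bigjoin (fun i => [set CodeSeq.code t | t in A i]))
       (bigjoin (fun i => [set CodeSeq.code t | t in ~` A i])).

Record iso L (A B : structure L) := Iso {
  iso_fun :> nat -> nat;
  iso_bij : bijective iso_fun;
  iso_rel : forall i (t : (L i).-tuple nat), A i t <-> B i (map_tuple iso_fun t)
}.

Lemma iso_id_rel L (A : structure L) i (t : (L i).-tuple nat) :
  A i t <-> A i (map_tuple id t).
Proof. by have -> : map_tuple id t = t by apply: val_inj; rewrite /= map_id. Qed.

Definition iso_id L (A : structure L) : iso A A :=
  Iso (Bijective (fun=> erefl) (fun=> erefl)) (@iso_id_rel L A).

Lemma iso_comp_rel L (A B C : structure L) (g : iso B C) (f : iso A B) i
    (t : (L i).-tuple nat) :
  A i t <-> C i (map_tuple (g \o f) t).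
Proof.
have -> : map_tuple (g \o f) t = map_tuple g (map_tuple f t).
  by apply: val_inj; rewrite /= map_comp.
exact: iff_trans (iso_rel f t) (iso_rel g _).
Qed.

Definition iso_comp L (A B C : structure L) (g : iso B C) (f : iso A B) :
    iso A C :=
  Iso (bij_comp (iso_bij g) (iso_bij f)) (iso_comp_rel g f).

(* A class of structures is a category whose morphisms are all isomorphisms
   between its members. *)
Definition Hom L (K : set (structure L)) (C D : K) := iso (\val C) (\val D).

Record functor L L' (K : set (structure L)) (K' : set (structure L')) :=
  Functor {
    fobj :> K -> K';
    fmap : forall C D : K, Hom C D -> Hom (fobj C) (fobj D);
    fmap_id : forall C : K, fmap (iso_id (\val C) : Hom C C) = iso_id _;
    fmap_comp : forall (C D E : K) (g : Hom D E) (f : Hom C D),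
      fmap (iso_comp g f : Hom C E) = iso_comp (fmap g) (fmap f)
  }.

Definition IsoClass L (A : structure L) : set (structure L) :=
  [set C | inhabited (iso C A)].

Definition hom_oracle L (K : set (structure L)) (C D : K) (f : Hom C D) :
    set nat :=
  join (join (diagram (\val C)) (graph f)) (diagram (\val D)).

Definition computable_functor L L' (K : set (structure L))
    (K' : set (structure L')) (F : functor K K') :=
  exists Phi Phis : turing_op, forall C1 C2 : K,
    turing_decides Phi (diagram (\val C1)) (diagram (\val (F C1))) /\
    forall f : Hom C1 C2, turing_computes Phis (hom_oracle f) (fmap F f).

Definition enumerable_functor L L' (K : set (structure L))
    (K' : set (structure L')) (F : functor K K') :=
  exists Psi Psis : set nat, ce Psi /\ ce Psis /\ forall C1 C2 : K,
    enum_apply Psi (diagram (\val C1)) = diagram (\val (F C1)) /\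
    forall f : Hom C1 C2, enum_apply Psis (hom_oracle f) = graph (fmap F f).

(* Main.v *)
Require Import Defs.
From mathcomp Require Import all_boot.
From mathcomp Require Import boolp classical_sets.
From mathcomp Require Import filter.

(** An enumeration operator sees only positive information about its oracle,
    while a program may also use that a number is absent from it.  For the
    oracles of a computable functor this makes no difference: every absence is
    witnessed by a presence.  A tuple lies outside a relation exactly when the
    diagram lists it in its negated half, and [pair_code x y] lies outside the
    graph of a function exactly when some [pair_code x y'] with [y' <> y] lies
    in it; a number that does not have the shape of an element of a diagram or
    of a graph is recognized by decoding it, since arities are computable.  A
    computable function producing such witnesses is called a refuter here
    ([refuter_diagram], [refuter_graph], [refuter_join]); it is the same for all
    structures of a language and for all isomorphisms.

    Given a refuter, one can replace every query [q] of a program by a search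
    through a finite set [E]: either [q] is in [E], or [E] contains a witness
    that [q] is not in the oracle, or the search does not end.  The result is a
    program without oracle that takes the code of [E] as an additional argument
    ([oracle_free]).  When [E] is a subset of [X] it only gives values that the
    original program gives with oracle [X] ([oracle_free_sound]), and every
    value given with oracle [X] is obtained from all sufficiently large finite
    parts of [X], because a halting computation asks finitely many questions
    ([oracle_free_complete]).  The pairs of an [E] and a number that this
    program accepts from [E] form a c.e. set, which is the enumeration operator
    ([enum_of_computes]).  Applying this to the two programs of the functor, for
    membership in the diagram and for the graph of the isomorphism, proves the
    theorem. *)

Set Implicit Arguments.
Unset Strict Implicit.
Unset Printing Implicit Defensive.

Local Open Scope nat_scope.
Local Open Scope classical_set_scope.

(** * Evaluation and recursive functions *)

Lemma eval_fun X n (c : recfun n) v y z :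
  eval X c v y -> eval X c v z -> y = z.
Proof.
elim: c v y z => [k||| k i|m k f IHf g IHg|k f IHf g IHg|k f IHf] v y z.
- by move=> /= -> ->.
- by move=> /= -> ->.
- by move=> /= -> ->.
- by move=> /= -> ->.
- move=> [w [gw fw]] [w' [gw' fw']].
  suff ww' : w = w' by subst w'; exact: IHf fw fw'.
  by apply: eq_from_tnth => i; exact: IHg (gw i) (gw' i).
- rewrite /=; elim: (thead v) y z => [|j IHj] y z; first exact: IHf.
  move=> [a [ha gy]] [b [hb gz]].
  by move: gz; rewrite -(IHj _ _ ha hb) => gz; exact: IHg gy gz.
- move=> [fy ltfy] [fz ltfz]; case: (ltngtP y z) => // [/ltfz|/ltfy] [a fa].
  + by have := IHf _ _ _ fy fa.
  + by have := IHf _ _ _ fz fa.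
Qed.

Definition recursive n (f : n.-tuple nat -> nat) :=
  exists c : recfun n, forall v, eval set0 c v (f v).

Definition computable2 (f : nat -> nat -> nat) :=
  recursive (fun v : 2.-tuple nat => f (nth 0 v 0) (nth 0 v 1)).

Lemma computableP f :
  computable f <-> recursive (fun v : 1.-tuple nat => f (nth 0 v 0)).
Proof.
split=> -[c cf]; exists c; last by move=> n; exact: cf [tuple n].
move=> v.
suff -> : v = [tuple nth 0 v 0] by exact: cf.
by apply: val_inj; case: v => -[|a [|//]].
Qed.

Lemma recursive_arg n i :
  i < n -> recursive (fun v : n.-tuple nat => nth 0 v i).
Proof.
by move=> ltin; exists (Proj (Ordinal ltin)) => v; rewrite /= (tnth_nth 0).
Qed.

Lemma recursive0 n : recursive (fun _ : n.-tuple nat => 0).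
Proof. by exists (Zero n). Qed.

Lemma recursive_comp1 n (F : n.-tuple nat -> nat) f :
  computable f -> recursive F -> recursive (fun v => f (F v)).
Proof.
move=> [c cf] [d dF]; exists (Comp c (fun=> d)) => v.
exists [tuple F v]; split; last exact: cf.
by move=> i; rewrite ord1; exact: dF.
Qed.

Lemma recursive_comp2 n (F G : n.-tuple nat -> nat) f :
  computable2 f -> recursive F -> recursive G ->
  recursive (fun v => f (F v) (G v)).
Proof.
move=> [c cf] [d dF] [e eG]; exists (Comp c (tnth [tuple d; e])) => v.
exists [tuple F v; G v]; split; last exact: cf.
by case=> [[|[|//]] lti]; [exact: dF | exact: eG].
Qed.

Lemma computable_succ : computable succn.
Proof. by exists Succ. Qed.

Lemma computable_id : computable id.
Proof. by exists (Proj ord0). Qed.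

Lemma recursive_const n a : recursive (fun _ : n.-tuple nat => a).
Proof.
elim: a => [|a IHa]; first exact: recursive0.
exact: recursive_comp1 computable_succ IHa.
Qed.

Lemma eval_Prec X m (f : recfun m) (g : recfun m.+2) (v : m.-tuple nat)
    (h : nat -> nat) (w : m.+1.-tuple nat) :
    eval X f v (h 0) ->
    (forall k, eval X g [tuple of k :: h k :: v] (h k.+1)) ->
  behead_tuple w = v -> eval X (Prec f g) w (h (thead w)).
Proof.
move=> fv gv wv; subst v; rewrite /=; elim: (thead w) => [|k IHk] //.
by exists (h k).
Qed.

Lemma computable_iteri g a :
  computable2 g -> computable (fun n => iteri n g a).
Proof.
move=> [c cg]; have [d da] := recursive_const 0 a.
exists (Prec d c) => n.
apply: (@eval_Prec _ _ _ _ [tuple] (fun n => iteri n g a)) => [//|k|].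
  exact: cg [tuple k; iteri k g a].
exact: val_inj.
Qed.

Lemma computable2_iter f : computable f -> computable2 (fun n => iter n f).
Proof.
move=> /recursive_comp1/(_ (@recursive_arg 3 1 isT)) [c cf].
exists (Prec (Proj ord0) c) => v.
case/tupleP: v => n v; case/tupleP: v => x v; rewrite tuple0.
apply: (@eval_Prec _ _ _ _ [tuple x] (fun n => iter n f x)) => [//|k|].
  exact: cf [tuple k; iter k f x; x].
exact: val_inj.
Qed.

Lemma computable_search (p : nat -> nat -> bool) f :
    computable2 (fun k x => ~~ p k x) ->
    (forall x, p (f x) x) -> (forall x k, k < f x -> ~~ p k x) ->
  computable f.
Proof.
move=> [c cp] pf ltf; exists (Mu c) => x; split=> [|k /ltf pk].
  by have := cp [tuple f x; x]; rewrite /= pf.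
by exists 0; have := cp [tuple k; x]; rewrite /= pk.
Qed.

(* [refine] postpones the proof of [i < n] until [n] is known from the goal. *)
Ltac arg i := refine (@recursive_arg _ i _); exact isT.

Lemma computable_pred : computable predn.
Proof.
have -> : predn = fun n => iteri n (fun k _ => k) 0 by apply/funext; case.
by apply: computable_iteri; arg 0.
Qed.

Lemma computable2_sub : computable2 subn.
Proof.
suff -> : subn = fun m n => iter n predn m.
  by apply: (recursive_comp2 (computable2_iter computable_pred)); [arg 1|arg 0].
apply/funext => m; apply/funext; elim=> [|n IHn]; first by rewrite subn0.
by rewrite subnS IHn.
Qed.

Lemma computable2_add : computable2 addn.
Proof.
suff -> : addn = fun m => iter m succn.
  exact: computable2_iter computable_succ.
apply/funext => m; apply/funext => n; elim: m => // m IHm.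
by rewrite addSn IHm.
Qed.

Lemma computable_double : computable double.
Proof.
apply/computableP.
have -> : double = fun n => n + n by apply/funext => n; rewrite addnn.
by apply: (recursive_comp2 computable2_add); arg 0.
Qed.

Lemma computable_eq0 : computable (eq_op^~ 0).
Proof.
have -> : (fun n => (n == 0) : nat) = fun n => iteri n (fun _ _ => 0) 1.
  by apply/funext; case.
by apply: computable_iteri; exact: recursive0.
Qed.

Section Tests.

Variable n : nat.
Implicit Types (p q : n.-tuple nat -> bool) (F G : n.-tuple nat -> nat).

Lemma recursive_eq0 F : recursive F -> recursive (fun v => F v == 0).
Proof. exact: recursive_comp1 computable_eq0. Qed.

Lemma recursive_neg p :
  recursive (fun v => p v) -> recursive (fun v => ~~ p v).
Proof.
move=> /recursive_eq0; congr recursive; by apply/funext => v; case: (p v).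
Qed.

Lemma recursive_leq F G :
  recursive F -> recursive G -> recursive (fun v => F v <= G v).
Proof.
move=> recF recG; apply: recursive_eq0.
exact: recursive_comp2 computable2_sub recF recG.
Qed.

Lemma recursive_or p q :
  recursive (fun v => p v) -> recursive (fun v => q v) ->
  recursive (fun v => p v || q v).
Proof.
move=> recp recq.
have := recursive_comp2 computable2_add recp recq.
move=> /recursive_eq0/recursive_neg.
by congr recursive; apply/funext => v; case: (p v) (q v) => [] [].
Qed.

Lemma recursive_and p q :
  recursive (fun v => p v) -> recursive (fun v => q v) ->
  recursive (fun v => p v && q v).
Proof.
move=> /recursive_neg recp /recursive_neg recq.
have := recursive_neg (recursive_or recp recq).
by congr recursive; apply/funext => v; rewrite negb_or !negbK.
Qed.

Lemma recursive_eq F G :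
  recursive F -> recursive G -> recursive (fun v => F v == G v).
Proof.
move=> recF recG.
have := recursive_and (recursive_leq recF recG) (recursive_leq recG recF).
by congr recursive; apply/funext => v; rewrite eqn_leq.
Qed.

Lemma recursive_if p F G :
  recursive (fun v => p v) -> recursive F -> recursive G ->
  recursive (fun v => if p v then F v else G v).
Proof.
move=> recp recF recG.
(* [iter b (fun=> 0) x] is x if b = 0 and 0 otherwise: the case distinction is a
   sum of which one term is erased. *)
have erase : computable2 (fun m => iter m (fun=> 0)).
  by apply: computable2_iter; apply/computableP; exact: recursive0.
have := recursive_comp2 computable2_add
  (recursive_comp2 erase (recursive_neg recp) recF)
  (recursive_comp2 erase recp recG).
by congr recursive; apply/funext => v; case: (p v); rewrite ?addn0.
Qed.

Lemma recursive_odd F : recursive F -> recursive (fun v => odd (F v)).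
Proof.
apply: (@recursive_comp1 _ _ (fun m => odd m)).
suff -> : (fun m => odd m : nat) = fun m => iteri m (fun _ b => b == 0) 0.
  by apply: computable_iteri; apply: recursive_comp1 computable_eq0 _; arg 1.
by apply/funext; elim=> //= m <-; case: odd.
Qed.

End Tests.

(** * Decoding *)

Lemma computable_half : computable half.
Proof.
suff -> : half = fun m => iteri m subn 0.
  by apply: computable_iteri; exact: computable2_sub.
apply/funext; elim=> //= m <-.
by rewrite uphalf_half -{3}(odd_double_half m) -addnn addnA addnK.
Qed.

Lemma iter_half k m : iter k half m = m %/ 2 ^ k.
Proof.
by elim: k => [|k IHk]; rewrite ?divn1 // iterS IHk -divn2 -divnMA expnSr.
Qed.

Lemma computable2_iter_half : computable2 (fun k => iter k half).
Proof. exact: computable2_iter computable_half. Qed.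

Definition code_head m := head 0 (CodeSeq.decode m).
Definition code_tail m := CodeSeq.code (behead (CodeSeq.decode m)).
Definition code_size m := size (CodeSeq.decode m).

(** The code of [a :: s] is [2 ^ a] times an odd number, so the head is the least
    number of halvings that lead to an odd number. *)
Lemma computable_code_head : computable code_head.
Proof.
apply: (@computable_search (fun k m => odd (iter k half m) || (m == 0))).
- apply/recursive_neg/recursive_or.
    exact: recursive_odd computable2_iter_half.
  by apply: recursive_eq0; arg 1.
- move=> m; rewrite -[m]CodeSeq.decodeK /code_head CodeSeq.codeK.
  case: (CodeSeq.decode m) => [|a s] //=.
  by rewrite iter_half mulKn ?expn_gt0 //= odd_double.
- move=> m k; rewrite -[m]CodeSeq.decodeK /code_head CodeSeq.codeK.
  case: (CodeSeq.decode m) => [|a s] //= ltka.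
  rewrite muln_eq0 expn_eq0 orbF iter_half -(subnKC ltka) addSnnS expnD expnS.
  by rewrite -!mulnA mulKn ?expn_gt0 // oddM.
Qed.

Lemma code_tailE m : code_tail m = (iter (code_head m) half m)./2.
Proof.
rewrite -[m in RHS]CodeSeq.decodeK /code_tail /code_head CodeSeq.codeK.
case: (CodeSeq.decode m) => [|a s] //=.
by rewrite iter_half mulKn ?expn_gt0 //= uphalf_double.
Qed.

Lemma computable_code_tail : computable code_tail.
Proof.
rewrite (funext code_tailE); apply/computableP.
apply: recursive_comp1 computable_half _.
apply: (recursive_comp2 computable2_iter_half); last by arg 0.
by apply: recursive_comp1 computable_code_head _; arg 0.
Qed.

Lemma iter_code_tail k m :
  iter k code_tail m = CodeSeq.code (drop k (CodeSeq.decode m)).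
Proof.
elim: k => [|k IHk]; first by rewrite drop0 CodeSeq.decodeK.
by rewrite iterS IHk /code_tail CodeSeq.codeK -drop1 drop_drop.
Qed.

Lemma code_eq0 s : (CodeSeq.code s == 0) = nilp s.
Proof. by case: s => //= a s; rewrite muln_eq0 expn_eq0. Qed.

(** The length is the least number of tails that lead to the empty sequence, whose
    code is 0. *)
Lemma computable_code_size : computable code_size.
Proof.
apply: (@computable_search (fun k m => iter k code_tail m == 0)).
- apply/recursive_neg/recursive_eq0.
  exact: computable2_iter computable_code_tail.
- by move=> m; rewrite iter_code_tail drop_size.
- move=> m k ltk; rewrite iter_code_tail code_eq0 /nilp size_drop.
  by rewrite subn_eq0 -ltnNge.
Qed.

Lemma computable2_pair_code : computable2 pair_code.
Proof.
have -> : pair_code = fun x y => iter x double (iter y double 1).*2.+1.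
  have e k z : iter k double z = 2 ^ k * z.
    by elim: k z => [|k IHk] z; rewrite ?mul1n // iterS IHk -mul2n mulnA expnS.
  by apply/funext => x; apply/funext => y; rewrite !e.
have dbl := computable2_iter computable_double.
apply: (recursive_comp2 dbl); first by arg 0.
apply/(recursive_comp1 computable_succ)/(recursive_comp1 computable_double).
by apply: (recursive_comp2 dbl); [arg 1 | exact: recursive_const].
Qed.

Lemma pair_codeK x y : CodeSeq.decode (pair_code x y) = [:: x; y].
Proof. exact: CodeSeq.codeK. Qed.

(** * Finite sets and their codes *)

Lemma finite_of_codeE u : finite_of_code u = [set x | odd (iter x half u)].
Proof. by apply/funext => x; rewrite /mkset iter_half. Qed.

Fixpoint bits_code (b : nat -> bool) n :=
  if n is n'.+1 then b 0 + (bits_code (b \o succn) n').*2 else 0.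

Lemma odd_bits_code b n x : odd (iter x half (bits_code b n)) = (x < n) && b x.
Proof.
elim: n b x => [|n IHn] b [|x] //=; first by rewrite -iterS iter_half div0n.
  by rewrite oddD odd_double addbF oddb.
rewrite -iterS iterSr half_bit_double; exact: IHn.
Qed.

Definition initial_code (X : set nat) n := bits_code (fun x => x \in X) n.

Lemma finite_initial_code X n :
  finite_of_code (initial_code X n) = [set x | x < n /\ X x].
Proof.
rewrite finite_of_codeE; apply/seteqP; split => x /=; rewrite odd_bits_code.
  by move=> /andP[ltxn /set_mem].
by move=> [ltxn /mem_set Xx]; apply/andP.
Qed.

(** * Replacing the oracle by a finite set *)

(** Unlike in [computable_search], a witness need not exist: the program halts
    exactly on the arguments that have one. *)
Lemma recursive_search n (p : n.+1.-tuple nat -> bool) :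
  recursive (fun v => ~~ p v) ->
  exists c : recfun n, forall v,
    (exists y, eval set0 c v y) <-> exists y, p [tuple of y :: v].
Proof.
move=> [c cp]; exists (Mu c) => v; split=> -[y].
  move=> [cy _]; exists y; have := eval_fun cy (cp _).
  by case: (p _).
move=> py.
have [m pm minm] := ex_minnP (ex_intro (fun z => p [tuple of z :: v]) y py).
exists m; split=> [|k ltkm]; first by have := cp [tuple of m :: v]; rewrite pm.
exists 0; have := cp [tuple of k :: v]; case pk: (p _) => //.
by have := minm k pk; rewrite leqNgt ltkm.
Qed.

(** The inner recursion of [eval] for [Prec], with the index and the remaining
    arguments as separate variables: rewriting either of them inside
    [behead_tuple w] is blocked by the dependency of types on [w]. *)
Definition prec_rel X n (f : recfun n) (g : recfun n.+2) (v : n.-tuple nat) :=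
  fix h (k : nat) : nat -> Prop :=
    if k is k'.+1
    then fun y => exists z, h k' z /\ eval X g [tuple of k' :: z :: v] y
    else eval X f v.

Lemma eval_PrecE X n (f : recfun n) (g : recfun n.+2) w k v y :
  thead w = k -> behead_tuple w = v ->
  eval X (Prec f g) w y = prec_rel X f g v k y.
Proof. by move=> wk wv; subst k v. Qed.

(** [P] answers a query from the query and a code of a finite set.  The code is
    added as the last argument, since recursion and minimization act on the
    first one: then [Prec] and [Mu] commute with the translation. *)
Fixpoint oracle_free (P : recfun 2) n (c : recfun n) : recfun n.+1 :=
  match c in recfun n return recfun n.+1 with
  | Zero n => Zero n.+1
  | Succ => Comp Succ (fun=> Proj ord0)
  | Oracle => P
  | Proj n i => Proj (lift ord_max i)
  | Comp m n f g => Comp (oracle_free P f) (fun j =>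
      if unlift ord_max j is Some i then oracle_free P (g i) else Proj ord_max)
  | Prec n f g => Prec (oracle_free P f) (oracle_free P g)
  | Mu n f => Mu (oracle_free P f)
  end.

Lemma tnth_rcons_lift n (v : n.-tuple nat) u i :
  tnth (rcons_tuple v u) (lift ord_max i) = tnth v i.
Proof.
by rewrite !(tnth_nth 0) lift_max nth_rcons size_tuple ltn_ord.
Qed.

Lemma tnth_rcons_max n (v : n.-tuple nat) u :
  tnth (rcons_tuple v u) ord_max = u.
Proof. by rewrite (tnth_nth 0) /= nth_rcons size_tuple ltnn eqxx. Qed.

Section OracleFree.

Variables (X : set nat) (P : recfun 2).

(** A query that [P] leaves unanswered makes the computation diverge, so correct
    answers to the answered queries ensure correct values. *)
Lemma oracle_free_sound u :
  (forall q b, eval set0 P [tuple q; u] b -> b = (q \in X)) ->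
  forall n (c : recfun n) v y,
    eval set0 (oracle_free P c) (rcons_tuple v u) y -> eval X c v y.
Proof.
move=> soundP n c.
elim: c => {n} [n|||n i|m n f IHf g IHg|n f IHf g IHg|n f IHf] v y.
- by [].
- move=> [w [w0 ->]]; rewrite [thead w]w0 /=.
  by case/tupleP: v w0.
- move=> Pv; apply: soundP; move: Pv; congr eval; apply: val_inj.
  by case/tupleP: v => q v; rewrite tuple0.
- by rewrite /= tnth_rcons_lift.
- move=> [w [gw fw]].
  exists [tuple tnth w (lift ord_max i) | i < m]; split=> [i|].
    rewrite tnth_mktuple; apply: IHg.
    by have := gw (lift ord_max i); rewrite liftK.
  apply: IHf; move: fw; congr eval; apply: eq_from_tnth => j.
  case: (unliftP ord_max j) => [i|] ->.
    by rewrite tnth_rcons_lift tnth_mktuple.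
  by have := gw ord_max; rewrite unlift_none /= !tnth_rcons_max.
- case/tupleP: v => k v.
  rewrite (@eval_PrecE _ _ _ _ _ k v) //; last exact: val_inj.
  rewrite (@eval_PrecE _ _ _ _ _ k (rcons_tuple v u)) //; last exact: val_inj.
  elim: k y => [|k IHk] y /=; first exact: IHf.
  move=> [z [/IHk hz gy]]; exists z; split=> //; apply: IHg.
  by move: gy; congr eval; apply: val_inj.
- have cons_rcons k :
      [tuple of k :: rcons_tuple v u] = rcons_tuple [tuple of k :: v] u.
    exact: val_inj.
  rewrite /= cons_rcons => -[/IHf fy lty]; split=> // k /lty[z].
  by rewrite cons_rcons => /IHf fz; exists z.
Qed.

(** Initial segments of [X] are used for the finite subsets because they form a
    chain: finitely many subcomputations that each succeed eventually succeed
    simultaneously. *)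
Lemma oracle_free_complete :
  (forall q, \forall N \near \oo,
    eval set0 P [tuple q; initial_code X N] (q \in X)) ->
  forall n (c : recfun n) v y, eval X c v y ->
    \forall N \near \oo,
      eval set0 (oracle_free P c) (rcons_tuple v (initial_code X N)) y.
Proof.
move=> completeP n c.
elim: c => {n} [n|||n i|m n f IHf g IHg|n f IHf g IHg|n f IHf] v y.
- by move=> /= ->; apply: filterE.
- move=> /= ->; apply: filterE => N; exists [tuple thead v]; split=> [i|//].
  by rewrite ord1; case/tupleP: v.
- move=> /= ->; apply: filterS (completeP (thead v)) => N; congr eval.
  by apply: val_inj; case/tupleP: v => q v; rewrite tuple0.
- by move=> /= ->; apply: filterE => N; rewrite tnth_rcons_lift.
- move=> [w [gw /IHf fw]].
  have gN : \forall N \near \oo, forall i,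
      eval set0 (oracle_free P (g i)) (rcons_tuple v (initial_code X N))
        (tnth w i).
    by apply: filter_forall => i; exact: IHg (gw i).
  apply: filterS2 fw gN => N {}fw {}gw.
  exists (rcons_tuple w (initial_code X N)); split=> // j.
  case: (unliftP ord_max j) => [i|] ->; first by rewrite tnth_rcons_lift.
  by rewrite /= !tnth_rcons_max.
- case/tupleP: v => k v.
  rewrite (@eval_PrecE _ _ _ _ _ k v) // => [hy|]; last exact: val_inj.
  suff : \forall N \near \oo, prec_rel set0 (oracle_free P f) (oracle_free P g)
      (rcons_tuple v (initial_code X N)) k y.
    apply: filterS => N.
    rewrite (@eval_PrecE _ _ _ _ _ k (rcons_tuple v (initial_code X N))) //.
    exact: val_inj.
  elim: k y hy => [|k IHk] y /=; first exact: IHf.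
  move=> [z [/IHk hz /IHg gy]]; apply: filterS2 hz gy => N hz gy.
  exists z; split=> //.
  by move: gy; congr eval; apply: val_inj.
- move=> [/IHf fy lty].
  have : forall k : 'I_y, exists z, eval X f [tuple of val k :: v] z.+1.
    by move=> k; exact: lty (ltn_ord k).
  move=> /fin_all_exists[z fz].
  have zN : \forall N \near \oo, forall k : 'I_y,
      eval set0 (oracle_free P f)
        (rcons_tuple [tuple of val k :: v] (initial_code X N)) (z k).+1.
    by apply: filter_forall => k; exact: IHf (fz k).
  apply: filterS2 fy zN => N {}fy {}fz.
  have cons_rcons k : [tuple of k :: rcons_tuple v (initial_code X N)] =
    rcons_tuple [tuple of k :: v] (initial_code X N) by exact: val_inj.
  rewrite /= cons_rcons; split=> // k ltky; exists (z (Ordinal ltky)).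
  by rewrite cons_rcons; exact: fz (Ordinal ltky).
Qed.

End OracleFree.

Lemma eval_Comp2 X n (f : recfun 2) (c d : recfun n) v y :
  eval X (Comp f (tnth [tuple c; d])) v y <->
  exists a b, [/\ eval X c v a, eval X d v b & eval X f [tuple a; b] y].
Proof.
split=> [[w [cdw fw]]|[a [b [ca db fab]]]].
  exists (tnth w ord0), (tnth w (lift ord0 ord0)).
  split; [exact: cdw ord0 | exact: cdw (lift ord0 ord0) | ].
  move: fw; congr eval; apply: eq_from_tnth.
  case=> [[|[|//]] lti];
  by rewrite (tnth_nth 0) /= (tnth_nth 0) [RHS](tnth_nth 0).
exists [tuple a; b]; split=> //.
by case=> [[|[|//]] lti].
Qed.

(** A numerical encoding of optional elements: 0 asks for nothing, and k.+1 asks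
    for the presence of k. *)
Definition certified (X : set nat) s := s = 0 \/ X s.-1.

(** A computable [d] enumerates the complement of [X] from [X], using at most one
    element of [X] at a time.  It is a separate argument so that one [d] can
    serve many sets [X]. *)
Definition refuter (d : nat -> nat -> nat) (X : set nat) :=
  forall q, ~ X q <-> exists w, certified X (d q w).

(** The search ends when [q] is found in the finite set or a witness against it
    is; in both cases membership in the finite set is then the right answer. *)
Lemma oracle_from_refuter d : computable2 d ->
  exists P : recfun 2, forall q u b,
    eval set0 P [tuple q; u] b <->
    b = (q \in finite_of_code u) /\
    exists w, finite_of_code u q \/ certified (finite_of_code u) (d q w).
Proof.
move=> cd.
have mem n (F G : n.-tuple nat -> nat) : recursive F -> recursive G ->
    recursive (fun v => odd (iter (F v) half (G v))).
  move=> recF recG; apply: recursive_odd.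
  exact: recursive_comp2 computable2_iter_half recF recG.
pose dv (v : 3.-tuple nat) := d (nth 0 v 1) (nth 0 v 0).
pose p (v : 3.-tuple nat) := odd (iter (nth 0 v 1) half (nth 0 v 2)) ||
  ((dv v == 0) || odd (iter (dv v).-1 half (nth 0 v 2))).
have rec_dv : recursive dv by apply: (recursive_comp2 cd); [arg 1|arg 0].
have [|s sP] := @recursive_search 2 p.
  apply/recursive_neg/recursive_or; first by apply: mem; [arg 1 | arg 2].
  apply: recursive_or; first exact: recursive_eq0.
  by apply: mem; [exact: recursive_comp1 computable_pred _ | arg 2].
have [m mP] : computable2 (fun q u => odd (iter q half u)).
  exact: recursive_odd computable2_iter_half.
exists (Comp (Proj ord0) (tnth [tuple m; s])) => q u b.
have Eb : (q \in finite_of_code u) = odd (iter q half u).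
  by rewrite finite_of_codeE; apply/idP/idP; rewrite inE.
have -> :
    (exists w, finite_of_code u q \/ certified (finite_of_code u) (d q w)) <->
    exists y, eval set0 s [tuple q; u] y.
  rewrite sP finite_of_codeE; split=> -[w] pw; exists w; move: pw.
    by rewrite /p /dv /certified /= => -[->|[->|->]] //; rewrite ?orbT.
  by rewrite /p /dv /certified /= => /or3P[|/eqP|]; auto.
rewrite Eb eval_Comp2; split=> [[a [y [ma sy ->]]]|[-> [y sy]]].
  by split; [exact: eval_fun ma (mP _) | exists y].
by exists (odd (iter q half u)), y; split=> //; exact: mP [tuple q; u].
Qed.

(** * From programs to enumeration operators *)

(** The search for [R] runs over a variable on which nothing depends: it ends at
    once or never, which turns a test of the value into convergence. *)
Lemma halts_when_accepted n (e : recfun 2) (F G H : n.-tuple nat -> nat)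
    (R : nat -> nat -> bool) :
    recursive F -> recursive G -> recursive H ->
    computable2 (fun x y => R x y) ->
  exists c : recfun n, forall v,
    (exists y, eval set0 c v y) <->
    exists2 z, eval set0 e [tuple F v; G v] z & R (H v) z.
Proof.
move=> recF recG recH cR.
have lift_rec K : recursive K ->
    exists c : recfun n.+1, forall k (v : n.-tuple nat),
      eval set0 c [tuple of k :: v] (K v).
  move=> [c cK]; exists (Comp c (fun i => Proj (lift ord0 i))) => k v.
  by exists v; split=> [i|//]; rewrite /= tnthS.
have [[f fP] [g gP]] := (lift_rec F recF, lift_rec G recG).
have [h hP] := lift_rec H recH; have [r rP] := recursive_neg cR.
pose b := Comp r (tnth [tuple h; Comp e (tnth [tuple f; g])]).
have bE k (v : n.-tuple nat) y : eval set0 b [tuple of k :: v] y <->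
    exists2 z, eval set0 e [tuple F v; G v] z & y = ~~ R (H v) z.
  rewrite eval_Comp2; split=> [[x [z [hx]]]|[z ez ->]].
    rewrite eval_Comp2 => -[a [a' [fa ga' ez]]] rxz; exists z.
      by rewrite (eval_fun (fP k v) fa) (eval_fun (gP k v) ga').
    by rewrite (eval_fun rxz (rP _)) (eval_fun (hP k v) hx).
  exists (H v), z; split; [exact: hP | | exact: rP [tuple H v; z]].
  by rewrite eval_Comp2; exists (F v), (G v).
exists (Mu b) => v; split=> [[y [/bE[z ez Rz] _]]|[z ez Rz]].
  by exists z => //; case: (R _ _) Rz.
by exists 0; split=> //; apply/bE; exists z => //; rewrite Rz.
Qed.

(** The relation [R] allows both a membership test of a decided set and a graph
    to be obtained from the values of [g]. *)
Lemma enum_of_computes d (Phi : turing_op) (l : nat -> nat)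
    (R : nat -> nat -> bool) :
    computable2 d -> computable l -> computable2 (fun x y => R x y) ->
  exists W, ce W /\ forall X g, refuter d X -> turing_computes Phi X g ->
    enum_apply W X = [set x | R x (g (l x))].
Proof.
move=> cd cl cR; have [P PE] := oracle_from_refuter cd.
(* On [pair_code u x], the program runs on [l x] and the finite set coded by
   [u]. *)
pose input (v : 1.-tuple nat) := code_head (code_tail (nth 0 v 0)).
have [c cP] : exists c : recfun 1, forall v,
    (exists y, eval set0 c v y) <->
    exists2 z, eval set0 (oracle_free P Phi)
        [tuple l (input v); code_head (nth 0 v 0)] z & R (input v) z.
  have rec_input : recursive input.
    apply: recursive_comp1 computable_code_head _.
    by apply: recursive_comp1 computable_code_tail _; arg 0.
  apply: halts_when_accepted => //; first exact: recursive_comp1 cl rec_input.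
  by apply: recursive_comp1 computable_code_head _; arg 0.
have inputE u x : input [tuple pair_code u x] = x.
  by rewrite /input /code_head /code_tail pair_codeK CodeSeq.codeK.
have headE u x : code_head (pair_code u x) = u by rewrite /code_head pair_codeK.
exists [set n | exists y, eval set0 c [tuple n] y]; split; first by exists c.
move=> X g dX PhiX; apply/seteqP; split=> x /=.
  move=> [u [uX /cP[z]]]; rewrite inputE headE => ez.
  suff /eval_fun/(_ (PhiX _)) -> : eval X Phi [tuple l x] z by [].
  apply: (@oracle_free_sound X P u); last first.
    by move: ez; congr eval; exact: val_inj.
  move=> q b /PE[-> [w [uq|cert]]].
    by rewrite !mem_set //; exact: uX.
  have nXq : ~ X q.
    by apply/dX; exists w; case: cert => [->|/uX]; [left | right].
  by rewrite !memNset // => /uX.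
move=> Rx; have completeP q : \forall N \near \oo,
    eval set0 P [tuple q; initial_code X N] (q \in X).
  have [Xq|nXq] := pselect (X q).
    exists q.+1 => // N /= ltqN; apply/PE.
    have uq : finite_of_code (initial_code X N) q.
      by rewrite finite_initial_code.
    by rewrite !mem_set //; split=> //; exists 0; left.
  have [w cert] := (dX q).1 nXq.
  (* The witness asked for by [d q w] is [(d q w).-1], which is below [N]. *)
  exists (d q w) => // N /= ledN; apply/PE; rewrite finite_initial_code.
  split; first by rewrite !memNset // => -[].
  exists w; right; case: cert => [|Xd]; first by left.
  have [->|dgt0] := posnP (d q w); first by left.
  by right; split=> //; rewrite prednK.
have [N /= eN] := filter_ex (oracle_free_complete completeP (PhiX (l x))).
exists (initial_code X N); split; first by rewrite finite_initial_code => y [].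
apply/cP; rewrite inputE headE; exists (g (l x)) => //.
by move: eN; congr eval; exact: val_inj.
Qed.

(** * Refuters for joins, graphs and diagrams *)

Lemma joinE X Y q : join X Y q <-> if odd q then Y q./2 else X q./2.
Proof.
split=> [[]|]; first by move=> [x Xx <-]; rewrite odd_double doubleK.
  by move=> [y Yy <-] /=; rewrite odd_double uphalf_double.
by rewrite -{4}(odd_double_half q); case: (odd q); [right|left]; exists q./2.
Qed.

(** The element k of a component appears in the join as k.*2 or k.*2.+1; the
    successors account for the encoding used by [certified]. *)
Definition join_refuter d e (q w : nat) : nat :=
  if odd q then (if e q./2 w == 0 then 0 else (e q./2 w).-1.*2.+2)
  else (if d q./2 w == 0 then 0 else (d q./2 w).-1.*2.+1).

Lemma computable2_join_refuter d e :
  computable2 d -> computable2 e -> computable2 (join_refuter d e).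
Proof.
move=> cd ce.
have half0 : recursive (fun v : 2.-tuple nat => (nth 0 v 0)./2).
  by apply: recursive_comp1 computable_half _; arg 0.
have rec_at f : computable2 f ->
    recursive (fun v : 2.-tuple nat => f (nth 0 v 0)./2 (nth 0 v 1)).
  by move=> cf; apply: (recursive_comp2 cf half0); arg 1.
have rec_dbl f : computable2 f ->
    recursive (fun v : 2.-tuple nat => (f (nth 0 v 0)./2 (nth 0 v 1)).-1.*2.+1).
  move=> cf; apply: recursive_comp1 computable_succ _.
  apply: recursive_comp1 computable_double _.
  exact: recursive_comp1 computable_pred (rec_at f cf).
apply: recursive_if; first by apply: recursive_odd; arg 0.
  apply: recursive_if; [exact/recursive_eq0/rec_at | exact: recursive0 |].
  exact: recursive_comp1 computable_succ (rec_dbl e ce).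
apply: recursive_if; [exact/recursive_eq0/rec_at | exact: recursive0 |].
exact: rec_dbl.
Qed.

Lemma refuter_join d e X Y :
  refuter d X -> refuter e Y -> refuter (join_refuter d e) (join X Y).
Proof.
move=> dX eY q; rewrite joinE /join_refuter.
have certE (s : nat) (b : bool) :
    certified (join X Y) (if s == 0 then 0 else s.-1.*2.+1 + b) <->
    certified (if b then Y else X) s.
  rewrite /certified; case: eqP => [->|]; first by split=> _; left.
  move=> /eqP; rewrite -lt0n => s_gt0.
  rewrite addSn /= joinE oddD odd_double oddb /= addnC half_bit_double.
  by split=> -[] //; case: b; auto; move: s_gt0; case: s.
case: (odd q).
  rewrite eY; split=> -[w cert]; exists w;
  by have := certE (e q./2 w) true; rewrite addn1; tauto.
rewrite dX; split=> -[w cert]; exists w;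
by have := certE (d q./2 w) false; rewrite addn0; tauto.
Qed.

(** The second component [w + (y <= w)] runs through all numbers other than
    y as w varies. *)
Definition graph_refuter (q w : nat) : nat :=
  if code_size q == 2 then
    (pair_code (code_head q) (w + (code_head (code_tail q) <= w))).+1
  else 0.

Lemma computable2_graph_refuter : computable2 graph_refuter.
Proof.
have rec_head n (F : n.-tuple nat -> nat) :
    recursive F -> recursive (fun v => code_head (F v)).
  exact: recursive_comp1 computable_code_head.
apply: recursive_if; last exact: recursive0.
  apply: recursive_eq; last exact: recursive_const.
  by apply: recursive_comp1 computable_code_size _; arg 0.
apply: recursive_comp1 computable_succ _.
apply: (recursive_comp2 computable2_pair_code); first by apply: rec_head; arg 0.
apply: (recursive_comp2 computable2_add); first by arg 1.
apply: recursive_leq; last by arg 1.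
by apply: rec_head; apply: recursive_comp1 computable_code_tail _; arg 0.
Qed.

Lemma code_size2 m : code_size m = 2 ->
  m = pair_code (code_head m) (code_head (code_tail m)).
Proof.
rewrite -[m]CodeSeq.decodeK /code_size /code_tail /code_head !CodeSeq.codeK.
by case: (CodeSeq.decode m) => [|a [|b []]].
Qed.

Lemma graph_pair_code f x y : graph f (pair_code x y) <-> f x = y.
Proof.
split=> [[z _ /(congr1 CodeSeq.decode)]|<-]; last by exists x.
by rewrite !pair_codeK => -[-> ->].
Qed.

Lemma refuter_graph f : refuter graph_refuter (graph f).
Proof.
move=> q; rewrite /graph_refuter; case: eqP => [/code_size2|size_q]; last first.
  split=> _; first by exists 0; left.
  by move=> [z _ zq]; apply: size_q; rewrite -zq /code_size pair_codeK.
set x := code_head q; set y := code_head _ => ->; rewrite graph_pair_code.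
split=> [fxy|[w [//|/graph_pair_code ->]]].
  have [ltfy|ltyf|//] := ltngtP (f x) y.
    by exists (f x); right; rewrite /= leqNgt ltfy addn0 graph_pair_code.
  exists (f x).-1; right; rewrite graph_pair_code /=.
  by rewrite -ltnS (ltn_predK ltyf) ltyf addn1 (ltn_predK ltyf).
by case: leqP => [leyw|ltwy] wy; [move: leyw | move: ltwy];
  rewrite -wy ?addn1 ?addn0 ltnn.
Qed.

(** The two halves of a diagram are interleaved, so that a tuple and its negation
    have adjacent codes: the number refuting q is q.-1 or q.+1, and its successor
    is returned, as [certified] requires.  Numbers that do not code an index
    together with a tuple of the right length are refuted unconditionally. *)
Definition diagram_refuter (L : language) (q w : nat) : nat :=
  let m := q./2 in
  if (code_size m == 2) &&
     (code_size (code_head (code_tail m)) == L (code_head m))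
  then (if odd q then q else q.+2) else 0.

Lemma computable2_diagram_refuter L : computable2 (diagram_refuter L).
Proof.
have half0 : recursive (fun v : 2.-tuple nat => (nth 0 v 0)./2).
  by apply: recursive_comp1 computable_half _; arg 0.
have rec_head n (F : n.-tuple nat -> nat) :
    recursive F -> recursive (fun v => code_head (F v)).
  exact: recursive_comp1 computable_code_head.
have rec_size n (F : n.-tuple nat -> nat) :
    recursive F -> recursive (fun v => code_size (F v)).
  exact: recursive_comp1 computable_code_size.
apply: recursive_if; last exact: recursive0.
  apply: recursive_and; apply: recursive_eq.
  - exact: rec_size.
  - exact: recursive_const.
  - by apply/rec_size/rec_head/(recursive_comp1 computable_code_tail).
  - by apply: recursive_comp1 (arity_computable L) _; exact: rec_head.
apply: recursive_if; [by apply: recursive_odd; arg 0 | by arg 0 |].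
by do 2 apply: recursive_comp1 computable_succ _; arg 0.
Qed.

Lemma bigjoin_code (L : language) (S : structure L) i (t : (L i).-tuple nat) :
  bigjoin (fun j => [set CodeSeq.code u | u in S j])
    (pair_code i (CodeSeq.code t)) <-> S i t.
Proof.
split=> [[j [x [[u Su <-] /(congr1 CodeSeq.decode)]]]|St].
  rewrite !pair_codeK => -[ij /(congr1 CodeSeq.decode)]; subst j.
  by rewrite !CodeSeq.codeK => /val_inj ->.
by exists i, (CodeSeq.code t); split=> //; exists t.
Qed.

Lemma refuter_diagram L (A : structure L) :
  refuter (diagram_refuter L) (diagram A).
Proof.
move=> q; rewrite /diagram joinE /diagram_refuter.
case: andP => [[/eqP/code_size2 mE /eqP]|ill]; last first.
  split=> [_|_]; first by exists 0; left.
  have illS (S : structure L) :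
      ~ bigjoin (fun i => [set CodeSeq.code t | t in S i]) q./2.
    move=> [i [x [[t St <-] mE]]]; apply: ill; rewrite mE.
    rewrite /code_size /code_head /code_tail pair_codeK CodeSeq.codeK /=.
    by rewrite CodeSeq.codeK size_tuple !eqxx.
  by case: (odd q); exact: illS.
set i := code_head _ in mE *; set c := code_head _ in mE * => sz.
have [t ct] : exists t : (L i).-tuple nat, c = CodeSeq.code t.
  exists (tcast sz (in_tuple (CodeSeq.decode c))).
  by rewrite val_tcast CodeSeq.decodeK.
rewrite ct in mE.
have sib : (if odd q then q else q.+2).-1 = ~~ odd q + q./2.*2.
  by rewrite -{2 3}(odd_double_half q); case: (odd q).
have cert : certified (diagram A) (if odd q then q else q.+2) <->
    if odd q then A i t else ~ A i t.
  rewrite /certified /diagram sib joinE oddD odd_double addbF oddb.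
  rewrite half_bit_double mE.
  split=> [[|]|At]; last right.
  - by case: (q) => // k /=; case: odd.
  - by case: (odd q) => /=; rewrite bigjoin_code.
  - by move: At; case: (odd q) => /=; rewrite bigjoin_code.
rewrite mE.
have -> :
    (exists _ : nat, certified (diagram A) (if odd q then q else q.+2)) <->
    if odd q then A i t else ~ A i t.
  by rewrite -cert; split=> [[]|]; [|exists 0].
case: (odd q); rewrite bigjoin_code //.
by split=> [nnA|At nA]; [exact: contrapT | exact: nA].
Qed.

Theorem theorem6 (LA LB : language) (A : structure LA) (B : structure LB)
    (F : functor (IsoClass A) (IsoClass B)) :
  computable_functor F -> enumerable_functor F.
Proof.
move=> [Phi [Phis PhiF]].
have cdiag := computable2_diagram_refuter LA.
(* Membership in the diagram: the value of the decision program is 1. *)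
have [Psi [cePsi PsiE]] := @enum_of_computes (diagram_refuter LA) Phi id
  (fun x y => y == 1) cdiag computable_id
  (recursive_eq (recursive_arg (isT : 1 < 2)) (recursive_const 2 1)).
have cjoin := computable2_join_refuter
  (computable2_join_refuter cdiag computable2_graph_refuter) cdiag.
(* Membership of x in the graph of g: x is the pair of its own head and the
   value of g there; this also excludes the x that are not pairs. *)
have cpair : computable2 (fun x y => pair_code (code_head x) y == x).
  apply: recursive_eq; last by arg 0.
  apply: (recursive_comp2 computable2_pair_code); last by arg 1.
  by apply: recursive_comp1 computable_code_head _; arg 0.
have [Psis [cePsis PsisE]] :=
  @enum_of_computes _ Phis _ _ cjoin computable_code_head cpair.
exists Psi, Psis; split=> //; split=> // C1 C2.
have [PhiC PhisC] := PhiF C1 C2; split.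
  rewrite (PsiE _ _ (refuter_diagram _) PhiC).
  by apply/seteqP; split=> x /=; rewrite eqb1 inE.
move=> f; rewrite (PsisE _ _ _ (PhisC f)).
  apply/seteqP; split=> x /=; first by move=> /eqP <-; exists (code_head x).
  by move=> [y _ <-]; rewrite /code_head pair_codeK.
apply: refuter_join (refuter_diagram _).
exact: refuter_join (refuter_diagram _) (refuter_graph _).
Qed.
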